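(* Let $k\ge1$, let $T=N^yE^x$, let $B$ be an arbitrary lattice path with steps $N=(0,1)$, $E=(1,0)$ from the origin to $(x,y)$, and let $\lambda=\lambda(T,B)$. There is a bijection $\Psi$ between the $k$-tuples $\mathbf P\in\mathcal P^k(T,B)$ with $h_i(\mathbf P)=h_i$ for $0\le i\le k$ and $u_s(\mathbf P)=u_s$ for $1\le s<y$, and the $k$-flagged semistandard Young tableaux of shape $\lambda$ and weight $$(\lambda_1-h_0,\lambda_1-h_1,\dots,\lambda_1-h_k,\,u_1,u_2,\dots,u_{y-1}).$$
   Context: $\mathcal P(T,B)$ is the set of lattice paths with steps $N,E$ from the origin to $(x,y)$ lying weakly above $B$ and weakly below $T$. $\mathcal P^k(T,B)$ is the set of $k$-tuples $\mathbf P=(P_1,\dots,P_k)$ of paths in $\mathcal P(T,B)$ with $P_i$ weakly above $P_{i+1}$. With $P_0=T$, $P_{k+1}=B$, $h_i(\mathbf P)$ is the number of east steps on which $P_i$ and $P_{i+1}$ coincide; for $1\le s\le y-1$, $u_s(\mathbf P)$ is the number of unit east steps of the lattice at $y$-coordinate $y-s$ lying strictly between $T$ and $B$ and not used by any of $P_1,\dots,P_k$. The region between $T$ and $B$ is the Young diagram (English notation) of a partition $\lambda(T,B)$ whose parts $x\ge\lambda_1\ge\dots\ge\lambda_y\ge0$ are the row lengths from top to bottom. A semistandard Young tableau of shape $\lambda$ is a filling with positive integers, weakly increasing along rows and strictly increasing down columns; it is $k$-flagged if every entry in row $r$ is at most $k+r$. Its weight is $(\mu_1,\mu_2,\dots)$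 with $\mu_i$ the number of entries equal to $i$.
   Formalization: The weight is corrected to (x−h_0,…,x−h_k,u_1,…,u_{y−1}) for arbitrary B; the printed weight with λ_1−h_i is proved only when λ_1=x, since it fails whenever λ_1<x (e.g. x=y=k=1, B=NE gives weight (−1,−1) but one tuple). *)

(* Defs.v *)
From HB Require Import structures.
From mathcomp Require Import all_boot all_order all_algebra.
From mathcomp Require Import mathcomp_extra boolp classical_sets functions.

Set Implicit Arguments.
Unset Strict Implicit.
Unset Printing Implicit Defensive.

Inductive step := North | East.

Definition bool_of_step (s : step) := if s is North then true else false.
Definition step_of_bool (b : bool) := if b then North else East.
Lemma bool_of_stepK : cancel bool_of_step step_of_bool.
Proof. by case. Qed.
HB.instance Definition _ := Finite.copy step (can_type bool_of_stepK).

Definition is_lpath (x y : nat) (p : seq step) : bool :=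
  (count_mem North p == y) && (count_mem East p == x).

(* The y-coordinates of the successive east steps of a path that starts at
   height [h]. *)
Fixpoint east_heights (h : nat) (p : seq step) : seq nat :=
  match p with
  | [::] => [::]
  | North :: p' => east_heights h.+1 p'
  | East :: p' => h :: east_heights h p'
  end.

(* A path from the origin has exactly one east step in each column a < x, the
   unit step from (a, ht p a) to (a+1, ht p a); it is determined by these. *)
Definition ht (p : seq step) (a : nat) : nat := nth 0 (east_heights 0 p) a.

Definition weakly_above (x : nat) (p q : seq step) : bool :=
  [forall a : 'I_x, ht q a <= ht p a].

Definition paths_between (x y : nat) (T B p : seq step) : bool :=
  [&& is_lpath x y p, weakly_above x T p & weakly_above x p B].

(* The tuple is indexed from 0, so P_i of the text is [tnth P (i - 1)]. *)
Definition path_tuples (x y k : nat) (T B : seq step)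
    (P : k.-tuple (seq step)) : bool :=
  all (paths_between x y T B) P && sorted (weakly_above x) P.

(* P_0 = T, P_1, ..., P_k, P_(k+1) = B. *)
Definition ext_path k (T B : seq step) (P : k.-tuple (seq step)) (i : nat) :
  seq step := nth B (T :: rcons P B) i.

Definition h_stat (x : nat) k (T B : seq step) (P : k.-tuple (seq step))
    (i : nat) : nat :=
  #|[pred a : 'I_x | ht (ext_path T B P i) a == ht (ext_path T B P i.+1) a]|.

Definition u_stat (x y : nat) k (T B : seq step) (P : k.-tuple (seq step))
    (s : nat) : nat :=
  #|[pred a : 'I_x | (ht B a < y - s < ht T a) &&
                     all (fun p => ht p a != y - s) P]|.

(* Row r (from the top, starting at 0) consists of the unit squares
   [a, a+1] x [y-r-1, y-r] between B and T; there are always y parts, some of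
   which may be 0. *)
Definition shape_between (x y : nat) (T B : seq step) : seq nat :=
  [seq #|[pred a : 'I_x | ht B a <= y - r.+1 < ht T a]| | r <- iota 0 y].

(* A cell is a pair of a row index r and a column index c < lam_r, both
   counted from 0. *)
Definition cell (lam : seq nat) : finType :=
  {r : 'I_(size lam) & 'I_(nth 0 lam r)}.
Definition row_of lam (c : cell lam) : nat := tag c.
Definition col_of lam (c : cell lam) : nat := tagged c.

Definition filling (lam : seq nat) := {ffun cell lam -> nat}.

Definition is_ssyt lam (t : filling lam) : bool :=
  [&& [forall c, 0 < t c],
      [forall c, forall d, (row_of c == row_of d) && (col_of c < col_of d)
                             ==> (t c <= t d)]
    & [forall c, forall d, (col_of c == col_of d) && (row_of c < row_of d)
                             ==> (t c < t d)]].

(* Row [row_of c] is row number (row_of c).+1 in the usual numbering. *)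
Definition is_flagged (k : nat) lam (t : filling lam) : bool :=
  [forall c, t c <= k + (row_of c).+1].

(* The weight mu_1, mu_2, ... of the tableau is the finite integer sequence
   [w], padded with zeros. *)
Definition has_weight lam (t : filling lam) (w : seq int) : Prop :=
  forall i : nat, (#|[pred c | t c == i.+1]|%:Z = nth 0 w i)%R.

(* (n - h_0, ..., n - h_k, u_1, ..., u_(y-1)), with subtraction in the
   integers. *)
Definition weight_seq (y k n : nat) (h u : nat -> nat) : seq int :=
  ([seq n%:Z - (h i)%:Z | i <- iota 0 k.+1] ++
   [seq (u s)%:Z | s <- iota 1 y.-1])%R.

Definition tuples_with (x y k : nat) (T B : seq step) (h u : nat -> nat) :
    set (k.-tuple (seq step)) :=
  [set P : k.-tuple (seq step) |
     [/\ path_tuples x y T B P,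
         forall i, i <= k -> h_stat x T B P i = h i
       & forall s, 1 <= s < y -> u_stat x y T B P s = u s]]%classic.

Definition flagged_tableaux (k : nat) (lam : seq nat) (w : seq int) :
    set (filling lam) :=
  [set t : filling lam |
     [/\ is_ssyt t, is_flagged k t & has_weight t w]]%classic.

Arguments tuples_with : clear implicits.
Arguments flagged_tableaux : clear implicits.

(* Main.v *)
(* The regions above P_1, ..., P_k, B form a chain of partitions
   0 = nu^0 <= nu^1 <= ... <= nu^(k+1) = lambda (a reverse plane partition):
   x - h_i is the number of columns met by the strip nu^(i+1) / nu^i, and u_s
   counts the columns in which rows s and s + 1 lie in a common strip. A
   k-flagged tableau is a chain of k + 1 horizontal strips followed, for
   s = 1, ..., y - 1, by a horizontal strip T_s confined to the rows below
   row s. Interpolate between the two kinds of strips: let X_j be the strips in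
   which vertical adjacencies are allowed between rows s and s + 1 for s <= j
   only. A Bender-Knuth reflection of the rows below row s proves
   X_(s-1) T_s = T_s X_s for the weighted transfer operators. Moving all T_s to
   the front, where they act trivially on the empty partition, turns
   X_0^(k+1) T_1 ... T_(y-1) into X_(y-1)^(k+1), so that both sides have the
   same generating function and a weight-preserving bijection exists.
   In the code rows are numbered from 0. *)
Require Import Defs.
From mathcomp Require Import all_boot all_order all_algebra zify.
From mathcomp Require Import mathcomp_extra boolp classical_sets functions.

Set Implicit Arguments.
Unset Strict Implicit.
Unset Printing Implicit Defensive.

Import GRing.Theory.

(** * Counting, cyclic cancellation and base expansions *)

Lemma iota_rcons m : iota 1 m.+1 = rcons (iota 1 m) m.+1.
Proof. by rewrite -cats1 -(addn1 m) iotaD addnC. Qed.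

(** A downward closed predicate holds on an initial segment, whose length is its cardinality. Row
    lengths, column lengths and tableau entries are all defined below as such cardinalities. *)
Lemma card_initial_segment n (Q : pred nat) :
    (forall a b, a <= b -> b < n -> Q b -> Q a) ->
  forall a, a < n -> (a < #|[pred i : 'I_n | Q i]|) = Q a.
Proof.
move=> dQ a lan.
have cardE m : m <= n -> #|[pred i : 'I_n | i < m]| = m.
  move=> lemn; rewrite -sum1_card (eq_bigl (fun i : 'I_n => i < m)) //.
  by rewrite -(big_ord_widen n (fun=> 1)) // sum1_card card_ord.
case Qa: (Q a).
  rewrite -{1}(cardE a.+1 lan); apply/subset_leq_card/fintype.subsetP=> i.
  by rewrite !inE ltnS => le_ia; apply: dQ Qa.
apply/negbTE; rewrite -leqNgt -(cardE a (ltnW lan)).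
apply/subset_leq_card/fintype.subsetP=> i; rewrite !inE ltnNge => Qi.
by apply: contraFN Qa => /dQ; apply.
Qed.

(** [f] and [g] differ by increments of [p] and [q], which cancel around the cycle because each
    takes equal values at 0 and [n]; the form avoids subtraction in [nat]. *)
Lemma sum_shift_potential n (f g p q : nat -> nat) :
    (forall i, i < n -> f i + p i + q i.+1 = g i + p i.+1 + q i) ->
    p 0 = p n -> q 0 = q n ->
  \sum_(i < n) f i = \sum_(i < n) g i.
Proof.
move=> fg p0n q0n.
have cyc (r : nat -> nat) : r 0 = r n -> \sum_(i < n) r i = \sum_(i < n) r i.+1.
  move=> r0n; apply: (@addIn (r n)); rewrite -(big_ord_recr n (fun i : 'I_n.+1 => r i)).
  by rewrite big_ord_recl -r0n addnC.
apply: (@addIn (\sum_(i < n) p i + \sum_(i < n) q i)).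
rewrite {1}(cyc q) // {2}(cyc p) // -!big_split /=.
by apply: eq_bigr => i _; have := fg i (ltn_ord i); lia.
Qed.

Lemma digits_inj D n (v w : nat -> nat) :
    (forall i, i < n -> v i < D) -> (forall i, i < n -> w i < D) ->
    \sum_(i < n) v i * D ^ i = \sum_(i < n) w i * D ^ i ->
  forall i, i < n -> v i = w i.
Proof.
elim: n v w => [|n IHn] v w vD wD //.
rewrite !big_ord_recl !muln1.
have factor u : \sum_(i < n) u (bump 0 i) * D ^ bump 0 i =
    (\sum_(i < n) u i.+1 * D ^ i) * D.
  by rewrite big_distrl; apply: eq_bigr => i _; rewrite /= expnSr mulnA.
rewrite !factor ![_ + _ * D]addnC => eqvw.
have D0 : 0 < D by apply: leq_ltn_trans (vD 0 _).
have /eqP := congr1 (modn^~ D) eqvw.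
rewrite !modnMDl !modn_small ?vD ?wD // => /eqP eq0.
move: eqvw; rewrite eq0 => /addIn/eqP; rewrite eqn_pmul2r // => /eqP eqS.
by case=> [|i] // ltin; apply: (IHn (v \o S) (w \o S)) => //= j ltjn; [apply: vD|apply: wD].
Qed.

(** * From equal generating functions to bijections *)

Section WeightedBijection.

Variables (A B : finType) (PA : pred A) (PB : pred B).

(** Each element is sent to the one at the same position in the enumeration of the opposite fibre;
    [b0] serves as the default of [nth]. *)
Lemma fiberwise_bijection (fA : A -> nat) (fB : B -> nat) (b0 : B) :
    (forall m, #|[pred a | PA a & fA a == m]| = #|[pred b | PB b & fB b == m]|) ->
  exists phi : A -> B,
    [/\ forall a, PA a -> PB (phi a) /\ fB (phi a) = fA a,
        forall a a', PA a -> PA a' -> phi a = phi a' -> a = a' &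
        forall b, PB b -> exists2 a, PA a & phi a = b].
Proof.
move=> cardAB.
pose eA m := enum [pred a | PA a & fA a == m].
pose eB m := enum [pred b | PB b & fB b == m].
have szAB m : size (eA m) = size (eB m) by rewrite -!cardE cardAB.
pose phi a := nth b0 (eB (fA a)) (index a (eA (fA a))).
have idxA a : PA a -> index a (eA (fA a)) < size (eB (fA a)).
  by move=> PAa; rewrite -szAB index_mem mem_enum inE PAa eqxx.
have phiP a : PA a -> PB (phi a) /\ fB (phi a) = fA a.
  move=> /idxA lti; have : phi a \in eB (fA a) by apply: mem_nth.
  by rewrite mem_enum inE => /andP[? /eqP].
exists phi; split=> // [a a' PAa PAa' eq_phi|b PBb].
  have eqf : fA a = fA a' by rewrite -(phiP _ PAa).2 eq_phi (phiP _ PAa').2.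
  have := idxA _ PAa; have := idxA _ PAa'; move: eq_phi; rewrite /phi eqf.
  move=> /eqP + lt' lt; rewrite nth_uniq ?enum_uniq // => /eqP eqi.
  by apply: (index_inj a _ _ eqi); rewrite mem_enum inE ?PAa ?PAa' ?eqf eqxx.
have eBb : b \in eB (fB b) by rewrite mem_enum inE PBb eqxx.
have lti : index b (eB (fB b)) < size (eA (fB b)) by rewrite szAB index_mem.
have [a0 _] : exists a0, a0 \in eA (fB b).
  by move: lti; case: (eA (fB b)) => // a0 s _; exists a0; rewrite mem_head.
pose a := nth a0 (eA (fB b)) (index b (eB (fB b))).
have : a \in eA (fB b) by apply: mem_nth.
rewrite mem_enum inE => /andP[PAa /eqP fAa]; exists a => //.
by rewrite /phi fAa /a index_uniq ?enum_uniq // nth_index.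
Qed.

(* Kronecker substitution [z i = D ^ i] with [D] above all the exponents turns
   the identity of generating functions into an equality of fibre sizes. *)
Lemma weighted_bijection n (wA : A -> nat -> nat) (wB : B -> nat -> nat)
    (b0 : B) :
    (forall z : nat -> nat,
       (\sum_(a | PA a) 'X^(\sum_(i < n) wA a i * z i) =
        \sum_(b | PB b) 'X^(\sum_(i < n) wB b i * z i) :> {poly int})%R) ->
  exists phi : A -> B,
    [/\ forall a, PA a -> PB (phi a) /\ forall i, i < n -> wB (phi a) i = wA a i,
        forall a a', PA a -> PA a' -> phi a = phi a' -> a = a' &
        forall b, PB b -> exists2 a, PA a & phi a = b].
Proof.
move=> genAB.
pose D := (\sum_a \sum_(i < n) wA a i + \sum_b \sum_(i < n) wB b i).+1.
have wAD a i : i < n -> wA a i < D.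
  move=> ltin; rewrite ltnS (bigD1 a) //= (bigD1 (Ordinal ltin)) //=.
  by rewrite -!addnA leq_addr.
have wBD b i : i < n -> wB b i < D.
  move=> ltin; rewrite ltnS addnC (bigD1 b) //= (bigD1 (Ordinal ltin)) //=.
  by rewrite -!addnA leq_addr.
pose code w := \sum_(i < n) w i * D ^ i.
have coefE (I : finType) (P : pred I) (f : I -> nat) m :
    ((\sum_(i | P i) 'X^(f i) : {poly int})`_m =
     #|[pred i | P i & f i == m]|%:R)%R.
  rewrite coef_sum -sum1_card natr_sum big_mkcondr /=.
  by apply: eq_bigr => i _; rewrite coefXn eq_sym; case: eqP.
have [|phi [phiP inj surj]] := @fiberwise_bijection (code \o wA) (code \o wB) b0.
  move=> m; have /(congr1 (fun p : {poly int} => p`_m)%R) := genAB (expn D).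
  by rewrite !coefE => /eqP; rewrite Num.Theory.eqr_nat => /eqP.
exists phi; split=> // a PAa; have [PBa eqc] := phiP a PAa; split=> // i ltin.
by apply: (@digits_inj D n (wB (phi a)) (wA a)) => // j ltj; [apply: wBD|apply: wAD].
Qed.

End WeightedBijection.

(** * Skew strips in a box *)

Section Shapes.

Variables x y : nat.

Definition boxshape := y.-tuple 'I_x.+1.

Implicit Types al be ga : boxshape.

(* Junk value 0 from row [y] on, as for a partition with [y] parts. *)
Definition rowlen al (i : nat) : nat := nth 0 (map val al) i.

(* The length of the row above row [i]; the row above row 0 has length [x]. *)
Definition up al (i : nat) : nat := if i is i'.+1 then rowlen al i' else x.

Definition mkshape (f : nat -> nat) : boxshape := [tuple inord (f i) | i < y].

Lemma rowlen_mkshape f i : (forall j, j < y -> f j <= x) -> i < y ->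
  rowlen (mkshape f) i = f i.
Proof.
move=> fx lti; rewrite /rowlen (nth_map ord0) ?size_tuple //.
have <- := tnth_nth ord0 (mkshape f) (Ordinal lti).
by rewrite tnth_mktuple /= inordK // ltnS fx.
Qed.

Lemma rowlen_default al i : y <= i -> rowlen al i = 0.
Proof. by move=> lei; rewrite /rowlen nth_default // size_map size_tuple. Qed.

Lemma rowlen_le al i : rowlen al i <= x.
Proof.
have [lti|/rowlen_default->//] := ltnP i y.
by rewrite /rowlen (nth_map ord0) ?size_tuple // -ltnS ltn_ord.
Qed.

Lemma shape_eq al be : (forall i, i < y -> rowlen al i = rowlen be i) -> al = be.
Proof.
move=> eq_row; apply: val_inj; apply: (inj_map val_inj).
apply: (@eq_from_nth _ 0) => [|i]; rewrite !size_map !size_tuple //.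
exact: eq_row.
Qed.

Definition partb al := [forall i : 'I_y, rowlen al i <= up al i].

Lemma partP al : reflect (forall i, rowlen al i <= up al i) (partb al).
Proof.
apply: (iffP forallP) => [pal i|pal i]; last exact: pal.
by have [lti|/rowlen_default->//] := ltnP i y; apply: (pal (Ordinal lti)).
Qed.

(* Strips in which a column may occupy both rows [i - 1] and [i] only if
   [i <= j]: horizontal strips for [j = 0], all skew shapes for [y <= j + 1]. *)
Definition stepX j al be :=
  [&& partb al, partb be & [forall i : 'I_y,
     (rowlen al i <= rowlen be i) && ((j < i) ==> (rowlen be i <= up al i))]].

Definition stepT s al be :=
  [&& partb al, partb be & [forall i : 'I_y,
     (rowlen al i <= rowlen be i <= up al i) && ((i < s) ==> (rowlen be i == rowlen al i))]].

(* Cells of row [i] of the strip with no cell of the strip above them. *)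
Definition topcells al be i := minn (rowlen be i) (up al i) - rowlen al i.

(* Columns that contain cells of the strip in both rows [i - 1] and [i]. *)
Definition overlap al be i := rowlen be i - up al i.

(** Each column met by the strip has exactly one top cell, so [a] records the number of these
    columns, while [b i] records the vertical adjacencies between rows [i - 1] and [i]. *)
Definition expX a (b : nat -> nat) al be :=
  \sum_(i < y) (a * topcells al be i + b i * overlap al be i).

Definition expT a al be := \sum_(i < y) a * (rowlen be i - rowlen al i).

Lemma stepXP j al be : reflect
  [/\ partb al, partb be & forall i, rowlen al i <= rowlen be i /\
      (j < i -> rowlen be i <= up al i)] (stepX j al be).
Proof.
apply: (iffP and3P) => -[pal pbe ok]; split=> //.
  move=> i; have [lti|lei] := ltnP i y; last by rewrite !rowlen_default.
  by have /andP[? /implyP] := forallP ok (Ordinal lti).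
by apply/forallP=> i; have [-> /implyP] := ok i.
Qed.

Lemma stepTP s al be : reflect
  [/\ partb al, partb be & forall i, rowlen al i <= rowlen be i <= up al i /\
      (i < s -> rowlen be i = rowlen al i)] (stepT s al be).
Proof.
apply: (iffP and3P) => -[pal pbe ok]; split=> //.
  move=> i; have [lti|lei] := ltnP i y; last by rewrite !rowlen_default.
  by have /andP[? /implyP eqi] := forallP ok (Ordinal lti); split=> // /eqi/eqP.
by apply/forallP=> i; have [-> eqi] := ok i; apply/implyP=> /eqi/eqP.
Qed.

Section Swap.

Variables (j : nat) (al ga : boxshape).
Let s := j.+1.

(** For either order of the two strips, the rows of the middle shape from [s] on range independently
    over the same intervals from [lo i] to [hi i]. The rows before [s] are forced: they agree with
    [ga] when [X] comes first and with [al] when [T] does. *)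
Let lo i := maxn (rowlen al i) (rowlen ga i.+1).
Let hi i := minn (rowlen ga i) (up al i).

Let between (f : nat -> nat) be := forall i, i < y ->
  if i < s then rowlen be i = f i else lo i <= rowlen be i <= hi i.

Let base := [/\ partb al, partb ga & forall i, i < s -> rowlen al i <= rowlen ga i].

(** From row [s] on, the bound [up al i] comes from the strip [X] and the bound [rowlen ga i.+1]
    from the horizontal strip [T]. *)
Let stepXT be : stepX j al be && stepT s be ga <-> base /\ between (rowlen ga) be.
Proof.
split=> [/andP[/stepXP[pal pbe albe] /stepTP[_ pga bega]]|].
  split=> [|i lti]; first by split=> // i ltis; have := albe i; have := bega i; lia.
  case: ifP => [ltis|leis]; first by have [_ ->] := bega i.
  have := albe i; have := bega i; have := bega i.+1; rewrite /lo /hi /=; lia.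
move=> [[pal pga alga] bebe].
have /partP pal' := pal; have /partP pga' := pga.
have pbe : partb be.
  apply/partP=> -[|i] /=; first exact: rowlen_le.
  have [lti|/rowlen_default->//] := ltnP i.+1 y.
  have := bebe i (ltnW lti); have := bebe _ lti; have := pga' i.+1.
  by rewrite /lo /hi /s /=; do 2!case: ifP; lia.
apply/andP; split.
  apply/stepXP; split=> // i; have [lti|lei] := ltnP i y; last by rewrite !rowlen_default.
  have := bebe i lti; have := alga i; rewrite /lo /hi; case: ifP; rewrite /s; lia.
apply/stepTP; split=> // i; have [lti|lei] := ltnP i y; last by rewrite !rowlen_default.
have := bebe i lti; have := pga' i; case: i lti => [|i] lti /=.
  by move=> _ ->; rewrite ?rowlen_le leqnn.
have := bebe i (ltnW lti); rewrite /lo /hi /s; do 2!case: ifP; lia.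
Qed.

(** The bounds exchange their sources: [up al i] now comes from [T], and [rowlen ga i.+1] from [X],
    whose horizontality is needed only after row [s]; hence [stepX s] in place of [stepX j]. *)
Let stepTX be : stepT s al be && stepX s be ga <-> base /\ between (rowlen al) be.
Proof.
split=> [/andP[/stepTP[pal pbe albe] /stepXP[_ pga bega]]|].
  split=> [|i lti]; first by split=> // i ltis; have := albe i; have := bega i; lia.
  case: ifP => [ltis|leis]; first by have [_ ->] := albe i.
  have := albe i; have := bega i; have := bega i.+1; rewrite /lo /hi /=; lia.
move=> [[pal pga alga] bebe].
have /partP pal' := pal; have /partP pga' := pga.
have pbe : partb be.
  apply/partP=> -[|i] /=; first exact: rowlen_le.
  have [lti|/rowlen_default->//] := ltnP i.+1 y.
  have := bebe i (ltnW lti); have := bebe _ lti; have := pal' i.+1.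
  by rewrite /lo /hi /s /=; do 2!case: ifP; lia.
apply/andP; split.
  apply/stepTP; split=> // i; have [lti|lei] := ltnP i y; last by rewrite !rowlen_default.
  have := bebe i lti; have := pal' i; rewrite /lo /hi; case: ifP; lia.
apply/stepXP; split=> // i; have [lti|lei] := ltnP i y; last by rewrite !rowlen_default.
have := bebe i lti; have := alga i; case: i lti => [|i] lti /=.
  by move=> + ->; lia.
have := bebe i (ltnW lti); rewrite /lo /hi /s; do 2!case: ifP; lia.
Qed.

(* The Bender-Knuth reflection of the rows of index at least [s]. *)
Let flip (f : nat -> nat) be :=
  mkshape (fun i => if i < s then f i else lo i + hi i - rowlen be i).

Let row_flip (f f' : nat -> nat) be i : (forall i, f i <= x) -> i < y ->
  between f' be ->
  rowlen (flip f be) i = if i < s then f i else lo i + hi i - rowlen be i.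
Proof.
move=> fx lti bebe; rewrite rowlen_mkshape // => l ltl; case: ifP => // ls.
have := bebe l ltl; rewrite ls; have := rowlen_le ga l; rewrite /hi; lia.
Qed.

Let between_flip (f f' : nat -> nat) be : (forall i, f i <= x) ->
  between f' be -> between f (flip f be).
Proof.
move=> fx bebe i lti; rewrite (row_flip fx lti bebe).
by have := bebe i lti; case: ifP => // _; lia.
Qed.

Let flipK (f f' : nat -> nat) be : (forall i, f i <= x) ->
  between f' be -> flip f' (flip f be) = be.
Proof.
move=> fx bebe; have f'x i : i < y -> i < s -> f' i <= x.
  by move=> lti ltis; have := bebe i lti; rewrite ltis => <-; apply: rowlen_le.
apply: shape_eq => i lti; rewrite rowlen_mkshape // => [|l ltl].
  by rewrite (row_flip fx lti bebe); have := bebe i lti; case: ifP => // _; lia.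
rewrite (row_flip fx ltl bebe); case: ifP => ls; first exact: f'x.
by have := bebe l ltl; rewrite ls; have := rowlen_le ga l; rewrite /hi; lia.
Qed.

(* The rowwise exponents on the two sides differ by shifts of the numbers
   [rowlen ga i - up al i]. *)
Let exp_swap a b be : base -> between (rowlen al) be ->
  expX a b al (flip (rowlen ga) be) + expT (b s) (flip (rowlen ga) be) ga =
  expT (b s) al be + expX a b be ga.
Proof.
move=> [pal pga alga] bebe; rewrite /expX /expT -!big_split /=.
have /partP pal' := pal; have /partP pga' := pga.
(* The cutoff at [s] gives [de 0 = 0] and the default row length gives [de y = 0], as the cyclic
   cancellation requires. *)
pose de i := if s < i then rowlen ga i - up al i else 0.
pose be' := flip (rowlen ga) be.
pose F i := a * topcells al be' i + b i * overlap al be' i +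
  b s * (rowlen ga i - rowlen be' i).
pose G i := b s * (rowlen be i - rowlen al i) +
  (a * topcells be ga i + b i * overlap be ga i).
have dey : de y = 0 by rewrite /de rowlen_default // if_same.
apply: (@sum_shift_potential y F G (fun i => a * de i) (fun i => b s * de i)) => /=;
  rewrite ?dey //.
move=> i lti.
have bei := bebe i lti.
have flipi : rowlen be' i = if i < s then rowlen ga i else lo i + hi i - rowlen be i.
  by apply: (@row_flip _ (rowlen al)) => // ?; apply: rowlen_le.
have upbe : i <= s -> up be i = up al i.
  case: (i) lti => [|l] ltl //= les.
  by have := bebe l (ltnW ltl); rewrite les.
have upga : s < i -> rowlen ga i <= up be i.
  case: (i) lti => [|l] ltl //= les.
  have := bebe l (ltnW ltl); rewrite ltnNge (les : s <= l) /lo /=; lia.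
have combine T1 T2 O1 O2 L R d d' : T1 + d = T2 + d' -> L + d' = R + d ->
    O1 = O2 ->
    a * T1 + b i * O1 + b s * L + a * d + b s * d' =
    b s * R + (a * T2 + b i * O2) + a * d' + b s * d.
  move=> /(congr1 (muln a)) + /(congr1 (muln (b s))) + ->.
  by rewrite !mulnDr; lia.
(* In row [s] the overlaps and the cells of [T] carry the same variable, so only their combined
   count has to balance. *)
have combine_eq c T1 T2 O1 O2 L R d d' : T1 + d = T2 + d' ->
    O1 + L + d' = R + O2 + d ->
    a * T1 + c * O1 + c * L + a * d + c * d' =
    c * R + (a * T2 + c * O2) + a * d' + c * d.
  move=> /(congr1 (muln a)) + /(congr1 (muln c)).
  by rewrite !mulnDr; lia.
have [pali pgai] := (pal' i, pga' i).
rewrite /F /G /topcells /overlap; move: flipi bei.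
have [ltis|ltsi|eqis] := ltngtP i s => flipi bei.
- rewrite flipi bei upbe ?(ltnW ltis) // /de; apply: combine => //.
  + by rewrite !ifN //; lia.
  + by rewrite !ifN //; lia.
- move: (upga ltsi) bei; rewrite /lo /hi in flipi *; rewrite flipi /de => ? ?.
  by apply: combine; rewrite ?ltsi ?(leqW ltsi) /=; lia.
- have {}upbe := upbe (eq_leq eqis); rewrite upbe.
  move: bei; rewrite /lo /hi in flipi *; rewrite flipi /de eqis ltnn ltnSn -eqis /= => ?.
  apply: combine_eq; lia.
Qed.

(** The reflection [flip] matches the middle shapes of the two orders and preserves the total
    exponent. This is one entry of the commutation relation between strips. *)
Lemma swap_strips a b :
  (\sum_(be : boxshape | stepX j al be && stepT s be ga)
     'X^(expX a b al be + expT (b s) be ga) =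
   \sum_(be : boxshape | stepT s al be && stepX s be ga)
     'X^(expT (b s) al be + expX a b be ga) :> {poly int})%R.
Proof.
have rx al' i : rowlen al' i <= x by apply: rowlen_le.
rewrite (reindex_onto (flip (rowlen ga)) (flip (rowlen al))) /=; last first.
  by move=> be /stepXT[_ bebe]; apply: flipK bebe.
have eq_step be : stepX j al (flip (rowlen ga) be) && stepT s (flip (rowlen ga) be) ga
    && (flip (rowlen al) (flip (rowlen ga) be) == be) = stepT s al be && stepX s be ga.
  apply/andP/idP => [[/stepXT[bs bebe] /eqP <-]|/stepTX[bs bebe]].
    by apply/stepTX; split=> //; apply: between_flip bebe.
  split; last by rewrite (flipK _ bebe).
  by apply/stepXT; split=> //; apply: between_flip bebe.
apply: eq_big => // be; rewrite eq_step => /stepTX[bs bebe].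
by rewrite exp_swap.
Qed.

End Swap.

End Shapes.

(** * Transfer kernels *)

Section TransferKernels.

Variable S : finType.

Definition kernel := S -> S -> {poly int}.

Definition mulk (A B : kernel) : kernel :=
  fun al ga => (\sum_be A al be * B be ga)%R.

Definition onek : kernel := fun al be => ((al == be)%:R)%R.

Definition prodk (l : seq kernel) : kernel := foldr mulk onek l.

Lemma mulkA : associative mulk.
Proof.
move=> A B C; apply/funext=> al; apply/funext=> de; rewrite /mulk.
under eq_bigr do rewrite big_distrr /=.
rewrite exchange_big /=; apply: eq_bigr => ga _.
by rewrite big_distrl; apply: eq_bigr => be _; rewrite mulrA.
Qed.

Lemma mul1k : left_id onek mulk.
Proof.
move=> A; apply/funext=> al; apply/funext=> ga; rewrite /mulk (bigD1 al) //=.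
rewrite /onek eqxx mul1r big1 ?addr0 // => be /negbTE.
by rewrite eq_sym => ->; rewrite mul0r.
Qed.

Lemma mulk1 : right_id onek mulk.
Proof.
move=> A; apply/funext=> al; apply/funext=> ga; rewrite /mulk (bigD1 ga) //=.
rewrite /onek eqxx mulr1 big1 ?addr0 // => be /negbTE.
by move=> ->; rewrite mulr0.
Qed.

Lemma prodk_cat l1 l2 : prodk (l1 ++ l2) = mulk (prodk l1) (prodk l2).
Proof. by elim: l1 => [|A l1 IHl] /=; rewrite ?mul1k // IHl mulkA. Qed.

Lemma prodk_rcons l A : prodk (rcons l A) = mulk (prodk l) A.
Proof. by rewrite -cats1 prodk_cat /= mulk1. Qed.

Definition letter := (rel S * (S -> S -> nat))%type.

Definition kernel_of (l : letter) : kernel :=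
  fun al be => (if l.1 al be then 'X^(l.2 al be) else 0)%R.

Lemma mulk_of (l1 l2 : letter) al ga :
  mulk (kernel_of l1) (kernel_of l2) al ga =
  (\sum_(be | l1.1 al be && l2.1 be ga) 'X^(l1.2 al be + l2.2 be ga))%R.
Proof.
rewrite [RHS]big_mkcond; apply: eq_bigr => be _; rewrite /kernel_of.
by case: l1.1; case: l2.1; rewrite ?mul0r ?mulr0 // exprD.
Qed.

Definition word_kernel (w : seq letter) : kernel := prodk (map kernel_of w).

Fixpoint chain_ok (w : seq letter) al (c : seq S) : bool :=
  if w is l :: w' then
    if c is be :: c' then l.1 al be && chain_ok w' be c' else false
  else true.

Fixpoint chain_exp (w : seq letter) al (c : seq S) : nat :=
  if w is l :: w' then
    if c is be :: c' then l.2 al be + chain_exp w' be c' else 0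
  else 0.

Lemma chain_okP (w : seq letter) al c : size c = size w -> reflect
  (forall (d : letter) i, i < size w ->
     (nth d w i).1 (nth al (al :: c) i) (nth al (al :: c) i.+1))
  (chain_ok w al c).
Proof.
elim: w al c => [|l w IHw] al [|be c] //=; first by left.
move=> [szc]; apply: (iffP andP) => [[ok /(IHw _ _ szc) oks] d [|i] lti //=|oks].
  have := oks d i lti; rewrite -!(set_nth_default be al) //= ?szc ?ltnS //.
  exact: ltnW.
have ok := oks l 0 isT; split=> //; apply/(IHw _ _ szc) => d i lti.
have := oks d i.+1 lti; rewrite /= -!(set_nth_default al be) //= ?szc ?ltnS //.
exact: ltnW.
Qed.

Lemma chain_expE (w : seq letter) al c d : size c = size w ->
  chain_exp w al c = \sum_(i < size w)
    (nth d w i).2 (nth al (al :: c) i) (nth al (al :: c) i.+1).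
Proof.
elim: w al c => [|l w IHw] al [|be c] //=; first by rewrite big_ord0.
move=> [szc]; rewrite big_ord_recl /= (IHw _ _ szc); congr addn.
apply: eq_bigr => i _ /=.
by rewrite -!(set_nth_default be al) //= ?szc ?ltnS // ltnW.
Qed.

(** An entry of a matrix product is a sum over walks; a walk is stored without its start [al]. The
    separate [n] lets the tuple length be given in closed form. *)
Lemma word_kernelE n (w : seq letter) al ga : size w = n ->
  word_kernel w al ga =
  (\sum_(c : n.-tuple S | chain_ok w al c && (last al c == ga))
     'X^(chain_exp w al c))%R.
Proof.
move=> <-{n}; elim: w al => [|l w IHw] al.
  rewrite big_mkcond (big_pred1 [tuple]) => [|c]; last first.
    by rewrite [c]tuple0 /= eqxx.
  by rewrite /word_kernel /= /onek; case: eqP.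
rewrite /word_kernel /= /mulk.
transitivity (\sum_be
  \sum_(c : (size w).-tuple S | chain_ok w be c && (last be c == ga))
    kernel_of l al be * 'X^(chain_exp w be c))%R.
  by apply: eq_bigr => be _; rewrite -big_distrr -IHw.
rewrite pair_big_dep /=.
rewrite (reindex (fun c : (size w).+1.-tuple S =>
  (thead c, behead_tuple c))) /=; last first.
  exists (fun p => cons_tuple p.1 p.2) => [c _|[be c] _].
    by rewrite [RHS]tuple_eta; apply: val_inj.
  by congr pair; apply: val_inj.
rewrite big_mkcond [RHS]big_mkcond /=; apply: eq_bigr => c _.
case/tupleP: c => be c; rewrite theadE /= -!andbA.
by rewrite /kernel_of; case: l.1; rewrite ?mul0r ?if_same //= exprD.
Qed.

End TransferKernels.

(** * Moving the [T] strips to the front *)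

Section Words.

Variables (x y : nat) (b : nat -> nat).

Notation S := (boxshape x y).

Definition letX j a : letter S := (stepX j, expX a b).
Definition letT s : letter S := (stepT s, expT (b s)).

Lemma swap_letters j a :
  mulk (kernel_of (letX j a)) (kernel_of (letT j.+1)) =
  mulk (kernel_of (letT j.+1)) (kernel_of (letX j.+1 a)).
Proof.
by apply/funext=> al; apply/funext=> ga; rewrite !mulk_of; apply: swap_strips.
Qed.

(** [X_0] passes [T_1] and becomes [X_1], which then passes [T_2], and so on up to [X_m]. *)
Lemma swap_letX_word m a :
  mulk (kernel_of (letX 0 a)) (word_kernel [seq letT s | s <- iota 1 m]) =
  mulk (word_kernel [seq letT s | s <- iota 1 m]) (kernel_of (letX m a)).
Proof.
elim: m => [|m IHm]; first by rewrite /word_kernel /= mulk1 mul1k.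
rewrite iota_rcons /word_kernel !map_rcons prodk_rcons -/(word_kernel _).
by rewrite mulkA IHm -[LHS]mulkA swap_letters mulkA.
Qed.

Lemma swap_words m (l : seq nat) :
  word_kernel ([seq letX 0 a | a <- l] ++ [seq letT s | s <- iota 1 m]) =
  word_kernel ([seq letT s | s <- iota 1 m] ++ [seq letX m a | a <- l]).
Proof.
elim: l => [|a l IHl]; first by rewrite cats0.
rewrite /word_kernel !map_cat !prodk_cat /= in IHl *.
have := swap_letX_word m a; rewrite /word_kernel => swap.
by rewrite -[LHS]mulkA IHl [LHS]mulkA swap [RHS]mulkA.
Qed.

Definition shape0 : S := mkshape x y (fun=> 0).

Lemma rowlen_shape0 (i : nat) : rowlen shape0 i = 0.
Proof. by have [lti|/rowlen_default//] := ltnP i y; rewrite rowlen_mkshape. Qed.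

(* A strip [T_s] with [1 <= s] cannot be added to the empty partition. *)
Lemma word_letT_shape0 (l : seq nat) (A : kernel S) ga : all (leq 1) l ->
  mulk (word_kernel [seq letT s | s <- l]) A shape0 ga = A shape0 ga.
Proof.
elim: l => [|s l IHl] /=; first by rewrite /word_kernel /= mul1k.
case/andP=> s0 /IHl{}IHl; rewrite /word_kernel /= -mulkA -/(word_kernel _).
rewrite {1}/mulk (bigD1 shape0) //= IHl big1 => [|be be0].
  rewrite addr0 /kernel_of /= ifT.
    by rewrite /expT big1 ?expr0 ?mul1r // => i _; rewrite rowlen_shape0 muln0.
  apply/stepTP; split; try by apply/partP=> i; rewrite rowlen_shape0.
  by move=> i; rewrite rowlen_shape0.
rewrite /kernel_of /= ifF ?mul0r //; apply: contraNF be0 => /stepTP[_ _ ok].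
(* Row 0 is fixed because [1 <= s]; each later row is bounded by an empty row above it. *)
apply/eqP/shape_eq => -[|i] _; first by have [_ ->] := ok 0.
by have [+ _] := ok i.+1; rewrite /= !rowlen_shape0; lia.
Qed.

End Words.

(** * Chains of shapes and their weights *)

Section ChainBijection.

Variables (x y k : nat) (lam : boxshape x y).

Notation S := (boxshape x y).
Notation N := (k.+1 + y.-1).

(** Chains omit their initial empty shape, which is restored here as stage 0. *)
Definition stage (c : seq S) i : S := nth (shape0 x y) (shape0 x y :: c) i.

Definition fan_chain (c : k.+1.-tuple S) : bool :=
  [forall i : 'I_k.+1, stepX y.-1 (stage c i) (stage c i.+1)]
  && (stage c k.+1 == lam).

(* Letter number [i] of a word carries the variable that records [x - h_i] for
   [i <= k] and [u_(i - k)] for [k < i]. *)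
Definition tableau_step i : rel S :=
  if i <= k then stepX 0 else stepT (i - k).

Definition tableau_chain (c : N.-tuple S) : bool :=
  [forall i : 'I_N, tableau_step i (stage c i) (stage c i.+1)]
  && (stage c N == lam).

Definition fan_weight (c : k.+1.-tuple S) i : nat :=
  if i <= k then \sum_(r < y) topcells (stage c i) (stage c i.+1) r
  else \sum_(l < k.+1) overlap (stage c l) (stage c l.+1) (i - k).

Definition tableau_weight (c : N.-tuple S) i : nat :=
  \sum_(r < y) (rowlen (stage c i.+1) r - rowlen (stage c i) r).

Section Genfun.

Variable z : nat -> nat.
(** One variable serves both [T_s] and the vertical adjacencies at row [s], as the commutation
    demands; its index [k + s] is the position of [u_s] in the weight. *)
Let b s := z (k + s).
Let fan_word := [seq letX x y b y.-1 (z i) | i <- iota 0 k.+1].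
Let tableau_word :=
  [seq letX x y b 0 (z i) | i <- iota 0 k.+1] ++
  [seq letT x y b s | s <- iota 1 y.-1].

Let size_fan_word : size fan_word = k.+1.
Proof. by rewrite size_map size_iota. Qed.

Let size_tableau_word : size tableau_word = N.
Proof. by rewrite size_cat !size_map !size_iota. Qed.

Let nth_fan_word d i : i < k.+1 -> nth d fan_word i = letX x y b y.-1 (z i).
Proof. by move=> lti; rewrite (nth_map 0) ?size_iota // nth_iota. Qed.

Let nth_tableau_word d i : i < N -> nth d tableau_word i =
  if i <= k then letX x y b 0 (z i) else letT x y b (i - k).
Proof.
move=> lti; rewrite nth_cat size_map size_iota ltnS.
case: ifP => leik; first by rewrite (nth_map 0) ?size_iota // nth_iota.
rewrite (nth_map 0) ?size_iota ?nth_iota; try lia.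
by congr letT; lia.
Qed.

Let last_stage n (c : n.-tuple S) : last (shape0 x y) c = stage c n.
Proof.
by rewrite /stage -nth_last size_tuple; case: n c => [|n] c //; rewrite tuple0.
Qed.

Let fan_okE (c : k.+1.-tuple S) :
  chain_ok fan_word (shape0 x y) c && (last (shape0 x y) c == lam) = fan_chain c.
Proof.
rewrite last_stage; congr andb.
have szc : size c = size fan_word by rewrite size_fan_word size_tuple.
apply/(chain_okP _ szc)/forallP => [ok i|ok d i].
  have := ok (letX x y b 0 0) i; rewrite size_fan_word nth_fan_word //.
  by move=> /(_ (ltn_ord i)).
by rewrite size_fan_word => lti; rewrite nth_fan_word //; apply: (ok (Ordinal lti)).
Qed.

Let tableau_okE (c : N.-tuple S) :
  chain_ok tableau_word (shape0 x y) c && (last (shape0 x y) c == lam) =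
  tableau_chain c.
Proof.
rewrite last_stage; congr andb.
have szc : size c = size tableau_word by rewrite size_tableau_word size_tuple.
apply/(chain_okP _ szc)/forallP => [ok i|ok d i].
  have := ok (letX x y b 0 0) i; rewrite size_tableau_word nth_tableau_word //.
  by rewrite /tableau_step; case: ifP => _ /(_ (ltn_ord i)).
rewrite size_tableau_word => lti; rewrite nth_tableau_word //.
by have := ok (Ordinal lti); rewrite /tableau_step /=; case: ifP.
Qed.

Let fan_expE (c : k.+1.-tuple S) :
  chain_exp fan_word (shape0 x y) c = \sum_(i < N) fan_weight c i * z i.
Proof.
have szc : size c = size fan_word by rewrite size_fan_word size_tuple.
rewrite (chain_expE _ (letX x y b 0 0) szc) size_fan_word.
transitivity (\sum_(i < k.+1) expX (z i) b (stage c i) (stage c i.+1)).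
  by apply: eq_bigr => i _; rewrite nth_fan_word.
rewrite big_split_ord /=.
under eq_bigr do rewrite /expX big_split /= -big_distrr /=.
rewrite big_split /=; congr addn.
  by apply: eq_bigr => i _; rewrite /fan_weight -ltnS ltn_ord mulnC.
rewrite exchange_big /=.
(* Row 0 has no row above it, hence no overlap; this leaves [y.-1] rows, one for each [u_s]. *)
have over0 : \sum_(l < k.+1) b 0 * overlap (stage c l) (stage c l.+1) 0 = 0.
  by rewrite big1 // => l _; apply/eqP; rewrite muln_eq0 subn_eq0 rowlen_le orbT.
have drop0 m (g : nat -> nat) : g 0 = 0 ->
    \sum_(i < m) g i = \sum_(i < m.-1) g i.+1.
  by case: m => [|m] g0; rewrite ?big_ord0 // big_ord_recl g0.
rewrite (drop0 _ (fun r =>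
  \sum_(l < k.+1) b r * overlap (stage c l) (stage c l.+1) r)) //.
apply: eq_bigr => i _; rewrite /fan_weight ifF; last by lia.
rewrite big_distrl; apply: eq_bigr => l _; rewrite mulnC /b.
by congr (overlap _ _ _ * z _); lia.
Qed.

(** The [X] strips of a valid chain are horizontal, so their overlaps vanish and every cell is a top
    cell. *)
Let tableau_expE (c : N.-tuple S) : tableau_chain c ->
  chain_exp tableau_word (shape0 x y) c = \sum_(i < N) tableau_weight c i * z i.
Proof.
case/andP=> /forallP ok _.
have szc : size c = size tableau_word by rewrite size_tableau_word size_tuple.
rewrite (chain_expE _ (letX x y b 0 0) szc) size_tableau_word.
apply: eq_bigr => i _; rewrite nth_tableau_word //; have := ok i.
rewrite /tableau_step /tableau_weight; case: ifP => leik.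
  move=> /stepXP[_ _ hstrip]; rewrite big_distrl; apply: eq_bigr => r _ /=.
  have := hstrip r; rewrite /topcells /overlap -/(stage c i).
  case: (r : nat) => [|r'] /=.
    have := rowlen_le (stage c i.+1) 0; rewrite -subn_eq0 => /eqP -> _.
    have /minn_idPl -> := rowlen_le (stage c i.+1) 0.
    by rewrite muln0 addn0 mulnC.
  case=> _ /(_ isT) hs; rewrite (minn_idPl hs).
  by move: hs; rewrite -subn_eq0 => /eqP ->; rewrite muln0 addn0 mulnC.
move=> _; rewrite big_distrl; apply: eq_bigr => r _ /=.
by rewrite mulnC /b; congr (_ * z _); lia.
Qed.

Lemma chain_genfun :
  (\sum_(c | fan_chain c) 'X^(\sum_(i < N) fan_weight c i * z i) =
   \sum_(c | tableau_chain c) 'X^(\sum_(i < N) tableau_weight c i * z i)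
   :> {poly int})%R.
Proof.
transitivity (word_kernel tableau_word (shape0 x y) lam); last first.
  rewrite (word_kernelE _ _ size_tableau_word); apply: eq_big => [c|c].
    exact: tableau_okE.
  by rewrite tableau_okE => /tableau_expE ->.
rewrite /tableau_word (map_comp (letX x y b 0) z) swap_words.
rewrite -(map_comp (letX x y b y.-1) z) -/fan_word.
rewrite /word_kernel map_cat prodk_cat.
have ge1 : all (leq 1) (iota 1 y.-1).
  by apply/allP=> s; rewrite mem_iota => /andP[].
have := word_letT_shape0 b (word_kernel fan_word) lam ge1.
rewrite /word_kernel => ->.
rewrite -/(word_kernel _) (word_kernelE _ _ size_fan_word).
by apply: eq_big => [c|c _]; [rewrite fan_okE|rewrite fan_expE].
Qed.

End Genfun.

Lemma chain_bijection : exists phi : k.+1.-tuple S -> N.-tuple S,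
  [/\ forall c, fan_chain c -> tableau_chain (phi c) /\
        forall i, i < N -> tableau_weight (phi c) i = fan_weight c i,
      forall c c', fan_chain c -> fan_chain c' -> phi c = phi c' -> c = c' &
      forall d, tableau_chain d -> exists2 c, fan_chain c & phi c = d].
Proof.
apply: weighted_bijection (chain_genfun).
exact: (nseq_tuple _ (shape0 x y)).
Qed.

End ChainBijection.

(** * Lattice paths as partitions *)

(** Rebuilds a path from the heights of its east steps; [h] is the current height, and the final
    north steps lead up to height [y]. *)
Fixpoint path_of_heights (y h : nat) (hs : seq nat) : seq step :=
  if hs is a :: hs' then nseq (a - h) North ++ East :: path_of_heights y a hs'
  else nseq (y - h) North.

Lemma size_east_heights h p : size (east_heights h p) = count_mem East p.
Proof. by elim: p h => [|[] p IHp] h //=; rewrite IHp. Qed.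

Lemma path_east_heights h p : path leq h (east_heights h p).
Proof.
elim: p h => [|[] p IHp] h //=; last by rewrite leqnn IHp.
by have := IHp h.+1; case: east_heights => //= a s /andP[/ltnW -> ->].
Qed.

Lemma last_east_heights h p :
  last h (east_heights h p) <= h + count_mem North p.
Proof.
elim: p h => [|[] p IHp] h //=; rewrite ?addn0 ?add0n //.
have := IHp h.+1; rewrite addnA addn1; case: east_heights => //= _.
by rewrite ltnW // ltnS leq_addr.
Qed.

Lemma path_of_heightsS y h hs : h < y -> path leq h.+1 hs ->
  path_of_heights y h hs = North :: path_of_heights y h.+1 hs.
Proof.
move=> lthy; case: hs => [|a hs] /=.
  by rewrite subnS; case: (y - h) (subn_gt0 h y) => [|n]; rewrite lthy.
case/andP=> lta _; rewrite subnS.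
by case: (a - h) (subn_gt0 h a) => [|n]; rewrite lta.
Qed.

Lemma east_heightsK h p :
  path_of_heights (h + count_mem North p) h (east_heights h p) = p.
Proof.
elim: p h => [|[] p IHp] h /=; first by rewrite addn0 subnn.
  rewrite path_of_heightsS ?path_east_heights //; last by lia.
  by rewrite -[in RHS](IHp h.+1) addnA addn1.
by rewrite subnn /= IHp.
Qed.

Lemma east_heights_nseq_north n h p :
  east_heights h (nseq n North ++ p) = east_heights (h + n) p.
Proof. by elim: n h => [|n IHn] h /=; rewrite ?addn0 // IHn addSnnS. Qed.

Lemma path_of_heightsK y h hs : path leq h hs ->
  east_heights h (path_of_heights y h hs) = hs.
Proof.
elim: hs h => [|a hs IHs] h /=.
  by rewrite -[nseq _ _]cats0 east_heights_nseq_north.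
by case/andP=> leha pa; rewrite east_heights_nseq_north /= subnKC // IHs.
Qed.

Lemma path_of_heights_is_lpath x y hs : path leq 0 hs -> last 0 hs <= y ->
  size hs = x -> is_lpath x y (path_of_heights y 0 hs).
Proof.
move=> p0 l0 <-; rewrite /is_lpath -(size_east_heights 0).
rewrite path_of_heightsK // eqxx andbT.
rewrite -[y in _ == y]subn0; elim: hs 0 p0 l0 => [|a hs IHs] h /=.
  by rewrite count_nseq mul1n.
case/andP=> leha pa lay; rewrite count_cat count_nseq /= mul1n.
rewrite (eqP (IHs _ pa lay)).
have leay : a <= y.
  apply: leq_trans lay; move: pa; case/lastP: hs {IHs} => // hs c.
  move/(order_path_min leq_trans)/allP; rewrite last_rcons; apply.
  by rewrite mem_rcons mem_head.
apply/eqP; lia.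
Qed.

Section LatticePaths.

Variables x y : nat.

Lemma ht_mono p a b : is_lpath x y p -> a <= b -> b < x -> ht p a <= ht p b.
Proof.
case/andP=> _ /eqP szx leab ltb; have srt := path_sorted (path_east_heights 0 p).
apply: (sorted_leq_nth leq_trans leqnn) => //;
  by rewrite inE size_east_heights szx //; lia.
Qed.

Lemma ht_le p a : is_lpath x y p -> ht p a <= y.
Proof.
move=> lp; have /andP[/eqP szy /eqP szx] := lp.
have [lta|lea] := ltnP a x; last by rewrite /ht nth_default // size_east_heights szx.
apply: leq_trans (ht_mono (b := x.-1) lp _ _) _; try lia.
have := last_east_heights 0 p; rewrite szy add0n; apply: leq_trans.
by rewrite /ht -szx -(size_east_heights 0) nth_last; case: east_heights.
Qed.

Lemma lpath_eq p q : is_lpath x y p -> is_lpath x y q ->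
  (forall a, a < x -> ht p a = ht q a) -> p = q.
Proof.
move=> /andP[/eqP Np /eqP Ep] /andP[/eqP Nq /eqP Eq] eqpq.
rewrite -(east_heightsK 0 p) -(east_heightsK 0 q) Np Nq.
congr path_of_heights; apply: (@eq_from_nth _ 0); rewrite !size_east_heights Ep //.
Qed.

(* The region above [p] in the [x] by [y] box. *)
Definition path_shape p : boxshape x y :=
  mkshape x y (fun r => #|[pred a : 'I_x | ht p a + r < y]|).

(** Heights increase weakly along a path, so the columns counted in row [r] form an initial segment;
    the squares of row [r] have their lower edges at height [y - r - 1]. *)
Lemma lt_path_shape p a r : is_lpath x y p -> a < x -> r < y ->
  (a < rowlen (path_shape p) r) = (ht p a + r < y).
Proof.
move=> lp lta ltr; rewrite rowlen_mkshape //; last first.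
  by move=> j _; rewrite -[leqRHS]card_ord max_card.
apply: (card_initial_segment (Q := fun a => ht p a + r < y)) => // b c lebc ltc.
by apply: leq_ltn_trans; rewrite leq_add2r ht_mono.
Qed.

Lemma boxshape_eqP (al be : boxshape x y) :
  (forall a r, a < x -> r < y -> (a < rowlen al r) = (a < rowlen be r)) ->
  al = be.
Proof.
move=> eqlt; apply: shape_eq => r ltr.
have [lex lex'] := (rowlen_le al r, rowlen_le be r).
have [lt|lt|//] := ltngtP (rowlen al r) (rowlen be r).
  by have := eqlt _ r (leq_trans lt lex') ltr; rewrite ltnn lt.
by have := eqlt _ r (leq_trans lt lex) ltr; rewrite ltnn lt.
Qed.

Lemma path_shape_le p q : is_lpath x y p -> is_lpath x y q ->
  weakly_above x p q <->
  forall r, rowlen (path_shape p) r <= rowlen (path_shape q) r.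
Proof.
move=> lp lq; split=> [/forallP pq r|leqr].
  have [ltr|/rowlen_default->//] := ltnP r y.
  rewrite leqNgt; apply/negP=> lt.
  have ltx := leq_trans lt (rowlen_le _ _).
  move: lt; rewrite lt_path_shape // => lt.
  have := lt_path_shape lq ltx ltr; rewrite ltnn.
  by have := pq (Ordinal ltx) => /=; lia.
apply/forallP=> a; rewrite leqNgt; apply/negP=> lt.
have hq := ht_le a lq.
(* In column [a], row [y - ht q a] is the first one below [q], while the assumed inequality places
   it above [p]. *)
have ltr : y - ht q a < y by lia.
have := leqr (y - ht q a); rewrite leqNgt => /negP; apply.
have np : ~~ (a < rowlen (path_shape q) (y - ht q a)).
  by rewrite lt_path_shape //; lia.
have : a < rowlen (path_shape p) (y - ht q a) by rewrite lt_path_shape //; lia.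
by move: np; lia.
Qed.

Lemma path_shape_inj p q : is_lpath x y p -> is_lpath x y q ->
  path_shape p = path_shape q -> p = q.
Proof.
move=> lp lq eqpq; apply: (lpath_eq lp lq) => a lta; apply/eqP; rewrite eqn_leq.
have /(path_shape_le lp lq)/forallP/(_ (Ordinal lta)) -> : forall r,
  rowlen (path_shape p) r <= rowlen (path_shape q) r by rewrite eqpq.
by have /(path_shape_le lq lp)/forallP/(_ (Ordinal lta)) -> : forall r,
  rowlen (path_shape q) r <= rowlen (path_shape p) r by rewrite eqpq.
Qed.

Lemma partb_path_shape p : is_lpath x y p -> partb (path_shape p).
Proof.
move=> lp; apply/partP=> -[|r] /=; first exact: rowlen_le.
have [ltr|/rowlen_default->//] := ltnP r.+1 y.
rewrite leqNgt; apply/negP=> lt; have ltx := leq_trans lt (rowlen_le _ _).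
have := lt_path_shape lp ltx (ltnW ltr); move: lt.
by rewrite lt_path_shape // ltnn; lia.
Qed.

Lemma rowlen_antimono (al : boxshape x y) r r' :
  partb al -> r <= r' -> rowlen al r' <= rowlen al r.
Proof.
move=> /partP pal /subnKC <-; elim: (r' - r) => [|n IHn]; rewrite ?addn0 //.
by apply: leq_trans IHn; rewrite addnS; apply: pal.
Qed.

(** The conjugate partition gives the path: in column [a] it runs at height [y - col a], where
    [col a] is the column length. *)
Lemma path_shape_surj (al : boxshape x y) : partb al ->
  exists2 p, is_lpath x y p & path_shape p = al.
Proof.
move=> pal; pose col a := #|[pred r : 'I_y | a < rowlen al r]|.
pose hs := [seq y - col a | a <- iota 0 x].
have colP a r : r < y -> (r < col a) = (a < rowlen al r).
  move=> ltr; apply: (card_initial_segment (Q := fun r => a < rowlen al r)) => //.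
  by move=> b c lebc _ lta; apply: leq_trans lta (rowlen_antimono pal lebc).
have col_anti a a' : a <= a' -> col a' <= col a.
  move=> leaa; apply/subset_leq_card/fintype.subsetP=> r; rewrite !inE.
  exact: leq_ltn_trans.
have srt : path leq 0 hs.
  apply/(pathP 0) => i; rewrite size_map size_iota => lti.
  case: i lti => [|i] lti //=; rewrite !(nth_map 0) ?size_iota ?nth_iota //; try lia.
  by rewrite leq_sub2l // col_anti.
have lasty : last 0 hs <= y.
  have : all (leq^~ y) hs by apply/allP=> _ /mapP[a _ ->]; rewrite leq_subr.
  by case/lastP: (hs) => // s a; rewrite all_rcons last_rcons => /andP[].
have szh : size hs = x by rewrite size_map size_iota.
have lp := path_of_heights_is_lpath srt lasty szh.
exists (path_of_heights y 0 hs) => //; apply: boxshape_eqP => a r lta ltr.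
rewrite lt_path_shape // -colP // /ht path_of_heightsK //.
rewrite (nth_map 0) ?size_iota // nth_iota // add0n.
have : col a <= y by rewrite -[leqRHS]card_ord max_card.
by lia.
Qed.

(** No row index below [y] exceeds [y.-1], so the condition against vertical adjacencies is void and
    only containment remains. *)
Lemma stepX_path_shape p q : is_lpath x y p -> is_lpath x y q ->
  stepX y.-1 (path_shape p) (path_shape q) = weakly_above x p q.
Proof.
move=> lp lq; apply/stepXP/idP => [[_ _ ok]|/(path_shape_le lp lq) le].
  by apply/(path_shape_le lp lq) => r; have [] := ok r.
split; try exact: partb_path_shape.
move=> i; split=> // lti; rewrite rowlen_default //; lia.
Qed.


Lemma card_interval n l u : u <= n ->
  u - l = \sum_(a < n) (l <= a < u : nat).
Proof.
elim: n u => [|n IHn] u leun; first by rewrite big_ord0; lia.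
rewrite big_ord_recr /=; move: leun; rewrite leq_eqVlt ltnS => /orP[/eqP ->|leun].
  have -> : \sum_(a < n) (l <= a < n.+1 : nat) =
      \sum_(a < n) (l <= a < n : nat).
    by apply: eq_bigr => a _; have := ltn_ord a; lia.
  by rewrite -IHn //; lia.
by rewrite -IHn //; lia.
Qed.

(** A column [a] meets the strip exactly when the paths differ there, and then it has a single top
    cell, just below [p] in row [y - ht p a]. *)
Lemma sum_topcells_path_shape p q : is_lpath x y p -> is_lpath x y q ->
  weakly_above x p q ->
  \sum_(r < y) topcells (path_shape p) (path_shape q) r =
  x - #|[pred a : 'I_x | ht p a == ht q a]|.
Proof.
move=> lp lq /forallP pq.
transitivity (\sum_(a < x) (ht q a < ht p a : nat)); last first.
  rewrite -[x in x - _]card_ord -(cardC [pred a : 'I_x | ht p a == ht q a]) addKn.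
  rewrite -sum1_card [RHS]big_mkcond; apply: eq_bigr => a _ /=; rewrite !inE.
  by have := pq a; case: ifP; lia.
under eq_bigr => r _ do rewrite /topcells (@card_interval x) ?geq_min ?rowlen_le //.
rewrite exchange_big /=; apply: eq_bigr => a _.
have ha := ht_le a lp; have pqa := pq a.
have [lt|ge] := ltnP (ht q a) (ht p a); last first.
  rewrite big1 // => r _; rewrite leq_min leqNgt !lt_path_shape //; lia.
have ltr : y - ht p a < y by lia.
rewrite (bigD1 (Ordinal ltr)) //= big1 => [|r /eqP ne].
  rewrite leq_min leqNgt !lt_path_shape //.
  case E : (y - ht p a) ltr => [|r] ltr /=; first by rewrite ltn_ord; lia.
  by rewrite lt_path_shape //; lia.
have {}ne : nat_of_ord r <> y - ht p a by move=> E; apply: ne; apply: val_inj.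
rewrite leq_min leqNgt !lt_path_shape //.
case: r ne => -[|r] ltr' /= ne; first by lia.
by rewrite lt_path_shape //; lia.
Qed.

(** Cells of the strip in rows [s - 1] and [s] of a column share an edge at height [y - s]: an east
    step strictly between the two paths. *)
Lemma overlap_path_shape p q s : is_lpath x y p -> is_lpath x y q ->
  1 <= s < y -> overlap (path_shape p) (path_shape q) s =
  \sum_(a < x) (ht q a < y - s < ht p a : nat).
Proof.
move=> lp lq /andP[s0 lts]; rewrite /overlap (@card_interval x) ?rowlen_le //.
apply: eq_bigr => a _; case: s s0 lts => // s _ lts /=.
by rewrite leqNgt !lt_path_shape ?(ltnW lts) //; have := ht_le a lp; lia.
Qed.

End LatticePaths.

(** A weakly decreasing sequence jumps over [v] at most once, and it fails to do so only if [v] is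
    attained or lies outside the range between its ends. *)
Lemma sum_crossings (f : nat -> nat) n v :
    (forall i, i <= n -> f i.+1 <= f i) ->
  \sum_(i < n.+1) (f i.+1 < v < f i : nat) =
  (f n.+1 < v < f 0) && all (fun i => f i != v) (iota 1 n).
Proof.
elim: n => [|n IHn] anti; first by rewrite big_ord_recl big_ord0 addn0 andbT.
rewrite big_ord_recr [LHS]/= IHn => [|i lein]; last by apply: anti; apply: leqW.
rewrite iota_rcons all_rcons.
have lefn := anti n.+1 (leqnn _).
(* Below [v], any jump is among the earlier steps; above [v], only the last step can jump; at [v],
   no jump occurs. *)
have [lt|gt|eqv] := ltngtP (f n.+1) v.
- by rewrite (leq_trans _ lt) ?ltnS //; case: all; rewrite ?andbT ?andbF; lia.
- rewrite /= andbT add0n.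
  have antif i d : i + d <= n.+1 -> f (i + d) <= f i.
    elim: d => [|d IHd]; rewrite ?addn0 // addnS => ltd.
    by apply: leq_trans (IHd (ltnW ltd)); apply: anti; apply: ltnW.
  have gtf i : i <= n.+1 -> v < f i.
    move=> lei; apply: leq_trans gt _.
    by have := antif i (n.+1 - i); rewrite subnKC // => ->.
  have -> : all (fun i => f i != v) (iota 1 n).
    apply/allP => i; rewrite mem_iota => /andP[_ lti].
    by rewrite neq_ltn gtf ?orbT //; lia.
  by rewrite !andbT (gtf 0) ?andbT.
by rewrite !andbF.
Qed.

(** * Tuples of paths as chains of shapes *)

Section Fans.

Variables (x y k : nat) (B : seq step).
Hypothesis lB : is_lpath x y B.

Notation S := (boxshape x y).
Notation T := (nseq y North ++ nseq x East).

Lemma top_is_lpath : is_lpath x y T.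
Proof.
by rewrite /is_lpath !count_cat !count_nseq /= !mul1n !mul0n addn0 !eqxx.
Qed.

Lemma ht_top a : a < x -> ht T a = y.
Proof.
have ehE n h : east_heights h (nseq n East) = nseq n h.
  by elim: n h => //= n IHn h; rewrite IHn.
by move=> lta; rewrite /ht east_heights_nseq_north ehE nth_nseq lta.
Qed.

Lemma path_shape_top : path_shape x y T = shape0 x y.
Proof.
apply: boxshape_eqP => a r lta ltr; rewrite lt_path_shape ?top_is_lpath //.
by rewrite rowlen_shape0 ht_top //; lia.
Qed.

Lemma weakly_above_trans : transitive (weakly_above x).
Proof.
move=> q p r /forallP pq /forallP qr; apply/forallP=> a.
exact: leq_trans (qr a) (pq a).
Qed.

Lemma top_weakly_above p : is_lpath x y p -> weakly_above x T p.
Proof. by move=> lp; apply/forallP=> a; rewrite ht_top // (ht_le _ lp). Qed.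

Implicit Types P : k.-tuple (seq step).

Lemma path_tuplesE P : path_tuples x y T B P =
  all (is_lpath x y) P && sorted (weakly_above x) (T :: rcons P B).
Proof.
rewrite (sorted_pairwise weakly_above_trans) /= pairwise_rcons all_rcons.
rewrite (top_weakly_above lB) /= /path_tuples (sorted_pairwise weakly_above_trans).
rewrite !andbA; congr andb; rewrite -!all_predI.
by apply: eq_all => p; rewrite /paths_between /= andbA.
Qed.

(** [T] is left out: its region is the empty shape, which is stage 0. *)
Definition fan_of P : k.+1.-tuple S :=
  [tuple of rcons (map (path_shape x y) P) (path_shape x y B)].

Lemma stage_fan_of P i : i <= k.+1 ->
  stage (fan_of P) i = path_shape x y (ext_path T B P i).
Proof.
move=> lei; rewrite /stage /= -map_rcons -path_shape_top -map_cons.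
rewrite (nth_map B) /=; last by rewrite size_rcons size_tuple ltnS.
by [].
Qed.

Lemma ext_path_is_lpath P i : all (is_lpath x y) P ->
  is_lpath x y (ext_path T B P i).
Proof.
move=> /allP lP; have [lti|lei] := ltnP i k.+2.
  have : ext_path T B P i \in T :: rcons P B.
    by apply: mem_nth; rewrite /= size_rcons size_tuple.
  by rewrite inE mem_rcons inE => /or3P[/eqP->|/eqP->|/lP//]; rewrite // top_is_lpath.
by rewrite /ext_path nth_default //= size_rcons size_tuple.
Qed.

Lemma fan_chain_fan_of P : all (is_lpath x y) P ->
  fan_chain (path_shape x y B) (fan_of P) = path_tuples x y T B P.
Proof.
move=> lP; rewrite path_tuplesE lP /= /fan_chain stage_fan_of //.
have -> : ext_path T B P k.+1 = B.
  by rewrite /ext_path /= nth_rcons size_tuple ltnn eqxx.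
rewrite eqxx andbT; apply/forallP/(pathP B) => ok i; have := ok.
  rewrite size_rcons size_tuple => {}ok lti; have := ok (Ordinal lti).
  by rewrite !stage_fan_of ?(ltnW lti) //= stepX_path_shape ?ext_path_is_lpath.
rewrite !stage_fan_of ?(ltnW (ltn_ord i)) // stepX_path_shape ?ext_path_is_lpath //.
by apply; rewrite size_rcons size_tuple.
Qed.

Lemma path_tuples_is_lpath P : path_tuples x y T B P -> all (is_lpath x y) P.
Proof. by rewrite path_tuplesE => /andP[]. Qed.

Lemma fan_of_inj P Q : path_tuples x y T B P -> path_tuples x y T B Q ->
  fan_of P = fan_of Q -> P = Q.
Proof.
move=> /path_tuples_is_lpath/allP lP /path_tuples_is_lpath/allP lQ.
move=> eqPQ; apply: val_inj.
apply: (@eq_from_nth _ B) => [|i]; rewrite !size_tuple // => lti.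
apply: (@path_shape_inj x y); [apply/lP|apply/lQ|]; rewrite ?mem_nth ?size_tuple //.
have := congr1 (fun c : k.+1.-tuple S => stage c i.+1) eqPQ.
rewrite !(stage_fan_of _ (ltnW (lti : i.+1 < k.+1))).
by rewrite /ext_path /= !nth_rcons !size_tuple lti.
Qed.

Lemma fan_of_surj c : fan_chain (path_shape x y B) c ->
  exists2 P, path_tuples x y T B P & fan_of P = c.
Proof.
move=> cok; have /andP[/forallP ok /eqP lastc] := cok.
(* [choice] asks for a path at every natural number; [B] fills the indices from [k] on. *)
have part i : exists p,
    is_lpath x y p /\ (i < k -> path_shape x y p = stage c i.+1).
  have [lti|] := ltnP i k; last by exists B.
  have /stepXP[_ pc _] := ok (Ordinal (ltnW lti : i < k.+1)).
  by have [p] := path_shape_surj pc; exists p.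
have [f fP] := choice part.
pose P : k.-tuple (seq step) := [tuple f i | i < k].
have lP : all (is_lpath x y) P.
  by apply/allP=> _ /mapP[i _ ->]; have [] := fP i.
have nthP i : i < k -> nth B P i = f i.
  by move=> lti; rewrite -(tnth_nth B P (Ordinal lti)) tnth_mktuple.
move: P lP nthP => P lP nthP; have fanP : fan_of P = c.
  apply: val_inj; apply: (@eq_from_nth _ (shape0 x y)) => [|i].
    by rewrite !size_tuple.
  rewrite !size_tuple ltnS leq_eqVlt => /orP[/eqP ->|lti].
    have := stage_fan_of P (leqnn _); rewrite /stage /= => ->.
    rewrite -[RHS]/(stage c k.+1) lastc /ext_path /=.
    by rewrite nth_rcons size_tuple ltnn eqxx.
  rewrite -[LHS]/(stage (fan_of P) i.+1) stage_fan_of; last exact: ltnW.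
  rewrite -[RHS]/(stage c i.+1) /ext_path /= nth_rcons size_tuple lti nthP //.
  by have [_ ->] := fP i.
by exists P => //; rewrite -fan_chain_fan_of // fanP.
Qed.

Lemma fan_weight_h_stat P i : path_tuples x y T B P -> i <= k ->
  fan_weight (fan_of P) i = x - h_stat x T B P i.
Proof.
move=> Pok leik; rewrite /fan_weight leik.
have lP := path_tuples_is_lpath Pok.
move: Pok; rewrite path_tuplesE lP /= => /(pathP B) => ok.
under eq_bigr => r _ do rewrite !stage_fan_of ?ltnS ?(leqW leik) //.
rewrite sum_topcells_path_shape ?ext_path_is_lpath //.
by apply: ok; rewrite size_rcons size_tuple.
Qed.

(** After the sums are exchanged, [sum_crossings] applies to each column: the edge at height [y - s]
    is jumped over once if it lies strictly between [T] and [B] and no path uses it, and never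
    otherwise. *)
Lemma fan_weight_u_stat P s : path_tuples x y T B P -> 1 <= s < y ->
  fan_weight (fan_of P) (k + s) = u_stat x y T B P s.
Proof.
move=> Pok lts; rewrite /fan_weight ifF ?addKn; last by lia.
have lP := path_tuples_is_lpath Pok.
move: Pok; rewrite path_tuplesE lP /= => /(pathP B) => ok.
transitivity (\sum_(l < k.+1) \sum_(a < x)
    (ht (ext_path T B P l.+1) a < y - s < ht (ext_path T B P l) a : nat)).
  apply: eq_bigr => l _; have ltl := ltn_ord l.
  by rewrite !stage_fan_of ?(ltnW ltl) // overlap_path_shape ?ext_path_is_lpath.
rewrite exchange_big /= /u_stat -sum1_card [RHS]big_mkcond /=; apply: eq_bigr => a _.
rewrite (@sum_crossings (fun l => ht (ext_path T B P l) a)) => [|i lei]; last first.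
  have := ok i; rewrite size_rcons size_tuple => /(_ lei)/forallP.
  exact.
rewrite /= inE /ext_path /= nth_rcons size_tuple ltnn eqxx.
have -> : all (fun i => ht (nth B (T :: rcons P B) i) a != y - s) (iota 1 k) =
    all (fun p => ht p a != y - s) P.
  rewrite -[in RHS](mkseq_nth B P) size_tuple all_map (iotaDl 1 0 k) all_map.
  apply: eq_in_all => i; rewrite mem_iota /= => lti.
  by rewrite nth_rcons size_tuple lti.
by case: (X in X && _).
Qed.

End Fans.

(** * Tableaux as chains of partitions *)

Section Tableaux.

(** [ls] and [lam] present one shape twice: as the sequence that types the cells and as the boxed
    partition that ends the chains. *)
Variables (x y k : nat) (ls : seq nat) (lam : boxshape x y).
Hypothesis size_ls : size ls = y.
Hypothesis nth_ls : forall r, nth 0 ls r = rowlen lam r.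

Notation N := (k.+1 + y.-1).
Notation S := (boxshape x y).

Implicit Types (c : N.-tuple S) (t : filling ls).

(** A uniform description of both kinds of steps. Step [i] inserts the entries [i.+1], so freezing
    row [r] when [k + r < i] is exactly the flag condition. *)
Lemma tableau_stepP i (al be : S) : reflect
  [/\ partb al, partb be & forall r, rowlen al r <= rowlen be r <= up al r /\
     (k + r < i -> rowlen be r = rowlen al r)] (tableau_step k i al be).
Proof.
rewrite /tableau_step; case: leqP => leik.
  apply: (iffP (stepXP _ _ _)) => -[pal pbe ok]; split=> // r; have := ok r.
    by case: r => [|r] /=; rewrite ?rowlen_le; lia.
  by lia.
by apply: (iffP (stepTP _ _ _)) => -[pal pbe ok]; split=> // r; have [-> eqr] := ok r;
  split=> // ltr; apply: eqr; lia.
Qed.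

Lemma row_of_lt (u : cell ls) : row_of u < y.
Proof. by rewrite -size_ls /row_of; case: (tag u). Qed.

Lemma col_of_lt (u : cell ls) : col_of u < rowlen lam (row_of u).
Proof. by rewrite -nth_ls /col_of /row_of; case: (tagged u). Qed.

Lemma cell_eq (u v : cell ls) : row_of u = row_of v -> col_of u = col_of v -> u = v.
Proof.
case: u v => [r a] [r' a']; rewrite /row_of /col_of /= => /val_inj eqr.
by case: r' / eqr a' => a' /val_inj ->.
Qed.

Lemma cell_at r a : r < y -> a < rowlen lam r ->
  exists2 u : cell ls, row_of u = r & col_of u = a.
Proof.
rewrite -nth_ls => ltry lta; have ltr : r < size ls by rewrite size_ls.
by exists (Tagged (fun r : 'I_(size ls) => 'I_(nth 0 ls r))
  (Ordinal lta : 'I_(nth 0 ls (Ordinal ltr)))).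
Qed.

(* A cell has entry at most [m] when it lies in the [m]-th shape of the
   chain. *)
Definition tableau_of c : filling ls :=
  [ffun u => #|[pred m : 'I_N | rowlen (stage c m) (row_of u) <= col_of u]|].

Section FromChain.

Variable c : N.-tuple S.
Hypothesis c_ok : tableau_chain lam c.

Lemma chain_step i : i < N -> tableau_step k i (stage c i) (stage c i.+1).
Proof. by move=> lti; case/andP: c_ok => /forallP/(_ (Ordinal lti)). Qed.

Lemma chain_mono m m' r : m <= m' -> m' <= N ->
  rowlen (stage c m) r <= rowlen (stage c m') r.
Proof.
move=> /subnKC <-; elim: (m' - m) => [|d IHd]; rewrite ?addn0 // addnS => ltN.
apply: leq_trans (IHd (ltnW ltN)) _.
by have /tableau_stepP[_ _ /(_ r)[/andP[]]] := chain_step ltN.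
Qed.

Lemma chain_last : stage c N = lam.
Proof. by case/andP: c_ok => _ /eqP. Qed.

Lemma tableau_of_le u m : m <= N ->
  (tableau_of c u <= m) = (col_of u < rowlen (stage c m) (row_of u)).
Proof.
(* [tableau_of] counts only indices below [N], so [m = N] is settled by the last shape [lam], which
   contains every cell. *)
rewrite ffunE leq_eqVlt => /orP[/eqP ->|ltm].
  by rewrite chain_last col_of_lt -[leqRHS]card_ord max_card.
rewrite leqNgt [in RHS]ltnNge; congr (~~ _).
apply: (card_initial_segment
  (Q := fun m => rowlen (stage c m) (row_of u) <= col_of u)) => //.
by move=> a b leab ltb; apply: leq_trans; rewrite chain_mono // ltnW.
Qed.

Lemma tableau_of_max u : tableau_of c u <= N.
Proof. by rewrite ffunE -[leqRHS]card_ord max_card. Qed.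

Lemma tableau_of_ssyt : is_ssyt (tableau_of c).
Proof.
apply/and3P; split; apply/forallP=> u.
- by rewrite lt0n -leqn0 tableau_of_le // /stage rowlen_shape0.
- apply/forallP=> v; apply/implyP=> /andP[/eqP eqr ltc].
  have leN := tableau_of_max v; rewrite (tableau_of_le _ leN) eqr.
  by apply: ltn_trans ltc _; rewrite -(tableau_of_le _ leN).
apply/forallP=> v; apply/implyP=> /andP[/eqP eqc ltr].
(* If the lower cell enters at step [m], horizontality of that step forces the cells above it in its
   column to be present at stage [m]. *)
case E : (tableau_of c v) (tableau_of_max v) => [|m] leN.
  by move: (leq0n 0); rewrite -{1}E tableau_of_le // /stage rowlen_shape0.
rewrite ltnS tableau_of_le ?(ltnW leN) // eqc.
have : col_of v < rowlen (stage c m.+1) (row_of v) by rewrite -tableau_of_le ?E.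
move=> /leq_trans; apply.
have /tableau_stepP[pm _ ok] := chain_step leN.
have [/andP[_ le] _] := ok (row_of v); apply: leq_trans le _.
by case: (row_of v) ltr => // r; rewrite ltnS => ler; apply: rowlen_antimono.
Qed.

Lemma tableau_of_flagged : is_flagged k (tableau_of c).
Proof.
apply/forallP=> u; have ltr := row_of_lt u.
rewrite tableau_of_le; last by lia.
(* The row no longer grows from this stage on, so it already has its final length. *)
have const d : k + (row_of u).+1 + d <= N ->
    rowlen (stage c (k + (row_of u).+1 + d)) (row_of u) =
    rowlen (stage c (k + (row_of u).+1)) (row_of u).
  elim: d => [|d IHd]; rewrite ?addn0 // addnS => ltN.
  rewrite -(IHd (ltnW ltN)); have /tableau_stepP[_ _ ok] := chain_step ltN.
  by have [_ ->] := ok (row_of u); lia.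
rewrite -(const (N - (k + (row_of u).+1))) subnKC ?chain_last ?col_of_lt //; lia.
Qed.

Lemma tableau_of_weight i : #|[pred u | tableau_of c u == i.+1]| =
  if i < N then tableau_weight c i else 0.
Proof.
case: ifP => ltN; last first.
  by apply: eq_card0 => u; rewrite !inE; have := tableau_of_max u; lia.
rewrite -sum1_card big_mkcond /=.
transitivity (\sum_(u : cell ls)
    (rowlen (stage c i) (row_of u) <= col_of u
       < rowlen (stage c i.+1) (row_of u) : nat)).
  apply: eq_bigr => u _; rewrite [u \in _]inE.
  have -> : (tableau_of c u == i.+1) =
    ~~ (tableau_of c u <= i) && (tableau_of c u <= i.+1) by lia.
  by rewrite !tableau_of_le ?(ltnW ltN) // -leqNgt; case: ifP.
rewrite -(@sig_big_dep _ _ _ _ (fun r : 'I_(size ls) => 'I_(nth 0 ls r))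
  xpredT (fun _ => xpredT)
  (fun r (a : 'I_(nth 0 ls r)) =>
  (rowlen (stage c i) r <= a < rowlen (stage c i.+1) r : nat))) /=.
have sum_ls (g : nat -> nat) : \sum_(r < y) g r = \sum_(r < size ls) g r.
  by rewrite size_ls.
rewrite /tableau_weight (sum_ls (fun r =>
  rowlen (stage c i.+1) r - rowlen (stage c i) r)); apply: eq_bigr => r _.
rewrite (@card_interval (nth 0 ls r)) // nth_ls -chain_last chain_mono //.
Qed.

End FromChain.

Lemma tableau_of_inj c d : tableau_chain lam c -> tableau_chain lam d ->
  tableau_of c = tableau_of d -> c = d.
Proof.
move=> cok dok eqt.
have stageE m : m <= N -> stage c m = stage d m.
  move=> leN; apply: boxshape_eqP => a r lta ltr.
  have [ltlam|gelam] := ltnP a (rowlen lam r).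
    have [u <- <-] := cell_at ltr ltlam.
    by rewrite -!tableau_of_le // eqt.
  have := chain_mono cok r leN (leqnn _); have := chain_mono dok r leN (leqnn _).
  by rewrite !chain_last //; lia.
apply: val_inj; apply: (@eq_from_nth _ (shape0 x y)) => [|i]; rewrite !size_tuple //.
by move=> lti; apply: (stageE i.+1 lti).
Qed.

Section FromTableau.

Variable t : filling ls.
Hypothesis part_lam : partb lam.
Hypotheses (t_ssyt : is_ssyt t) (t_flag : is_flagged k t).

(** Stated for arbitrary coordinates and false outside the shape, so that sublevel sets can be
    counted over all [x] columns. *)
Let entry_le (m r a : nat) : bool :=
  [exists u : cell ls, [&& row_of u == r, col_of u == a & t u <= m]].

Let entry_leE m u : entry_le m (row_of u) (col_of u) = (t u <= m).
Proof.
apply/existsP/idP => [[v /and3P[/eqP er /eqP ec]]|le].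
  by rewrite (cell_eq er ec).
by exists u; rewrite !eqxx.
Qed.

Let sub m : S := mkshape x y (fun r => #|[pred a : 'I_x | entry_le m r a]|).

Let lt_sub m r a : a < x -> r < y -> (a < rowlen (sub m) r) = entry_le m r a.
Proof.
move=> lta ltr; rewrite rowlen_mkshape //; last first.
  by move=> ? _; rewrite -[leqRHS]card_ord max_card.
apply: (card_initial_segment (Q := entry_le m r)) => // b d lebd _.
move=> /existsP[u /and3P[/eqP er /eqP ec le]].
have ltb : b < rowlen lam r by rewrite -er (leq_ltn_trans lebd) // -ec col_of_lt.
have [v vr vc] := cell_at ltr ltb; rewrite -vr -vc entry_leE.
move: lebd; rewrite -vc -ec leq_eqVlt => /orP[/eqP eqc|ltc].
  by rewrite (cell_eq (etrans vr (esym er)) eqc).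
apply: leq_trans le; case/and3P: t_ssyt => _ /forallP/(_ v)/forallP/(_ u)/implyP + _.
by apply; rewrite vr er eqxx.
Qed.

Let lt_sub_cell m u : (col_of u < rowlen (sub m) (row_of u)) = (t u <= m).
Proof.
rewrite lt_sub ?row_of_lt // ?entry_leE //.
exact: leq_trans (col_of_lt u) (rowlen_le _ _).
Qed.

Let sub_le m r b : (forall u, row_of u = r -> t u <= m -> col_of u < b) ->
  r < y -> rowlen (sub m) r <= b.
Proof.
move=> ok ltr; rewrite leqNgt; apply/negP=> lt.
have ltx := leq_trans lt (rowlen_le _ _); move: lt; rewrite lt_sub //.
by move=> /existsP[u /and3P[/eqP er /eqP ec /(ok _ er)]]; rewrite ec ltnn.
Qed.

Let col_strict u r : row_of u = r.+1 ->
  exists2 v, row_of v = r /\ col_of v = col_of u & t v < t u.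
Proof.
move=> ur; have ltr := row_of_lt u; rewrite ur in ltr.
have lta : col_of u < rowlen lam r.
  by apply: leq_trans (col_of_lt u) _; rewrite ur; have /partP/(_ r.+1) := part_lam.
have [v vr vc] := cell_at (ltnW ltr) lta; exists v => //.
case/and3P: t_ssyt => _ _ /forallP/(_ v)/forallP/(_ u)/implyP; apply.
by rewrite vc vr ur eqxx ltnSn.
Qed.

Let flag u : t u <= k + (row_of u).+1.
Proof. exact: (forallP t_flag u). Qed.

Let sub_part m : partb (sub m).
Proof.
apply/partP=> -[|r] /=; first exact: rowlen_le.
have [ltr|/rowlen_default->//] := ltnP r.+1 y.
apply: sub_le => // u ur le; have [v [vr <-] lt] := col_strict ur.
by rewrite -vr lt_sub_cell; lia.
Qed.

Let sub0 : sub 0 = shape0 x y.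
Proof.
apply: shape_eq => r ltr; rewrite rowlen_shape0; apply/eqP; rewrite -leqn0.
apply: sub_le => // u _.
by case/and3P: t_ssyt => /forallP/(_ u) + _ _; lia.
Qed.

(** Every flag is at most [k + y], which equals [N] once there is a row. *)
Let subN : sub N = lam.
Proof.
apply: shape_eq => r ltr; apply/eqP; rewrite eqn_leq.
rewrite sub_le // => [|u <- _]; last exact: col_of_lt.
rewrite leqNgt; apply/negP=> /(cell_at ltr)[u ur uc].
move: (lt_sub_cell N u); rewrite ur uc ltnn => /esym/negP; apply.
by have := flag u; rewrite ur; lia.
Qed.

(** Column strictness makes the strips horizontal, and the flags freeze row [r] once [k + r < i]. *)
Let sub_step i : tableau_step k i (sub i) (sub i.+1).
Proof.
apply/tableau_stepP; split; try exact: sub_part.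
move=> r; have [ltr|lery] := ltnP r y; last by rewrite !rowlen_default.
have le : rowlen (sub i) r <= rowlen (sub i.+1) r.
  by apply: sub_le => // u <- le; rewrite lt_sub_cell leqW.
rewrite le /=; split=> [|ltk].
  case: r ltr {le} => [|r] ltr /=; first exact: rowlen_le.
  apply: sub_le => // u ur leu; have [v [vr <-] lt] := col_strict ur.
  by rewrite -vr lt_sub_cell; lia.
apply/eqP; rewrite eqn_leq le andbT; apply: sub_le => // u ur _.
by rewrite -ur lt_sub_cell; have := flag u; rewrite ur; lia.
Qed.

Lemma tableau_of_surj : exists2 c, tableau_chain lam c & tableau_of c = t.
Proof.
pose c : N.-tuple S := [tuple sub i.+1 | i < N].
have stageE m : m <= N -> stage c m = sub m.
  case: m => [|m] ltm; rewrite /stage /= ?sub0 //.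
  by rewrite -(tnth_nth _ c (Ordinal ltm)) tnth_mktuple.
have c_ok : tableau_chain lam c.
  rewrite /tableau_chain stageE // subN eqxx andbT; apply/forallP=> i.
  by rewrite !stageE ?(ltnW (ltn_ord i)) ?(ltn_ord i) // sub_step.
exists c => //; apply/ffunP=> u.
have leN : t u <= N by rewrite -lt_sub_cell subN col_of_lt.
apply/eqP; rewrite eqn_leq tableau_of_le // stageE // lt_sub_cell leqnn /=.
have leN' := tableau_of_max c u.
by rewrite -lt_sub_cell -stageE // -tableau_of_le.
Qed.

End FromTableau.

End Tableaux.

(** * Reading off weights and assembling the bijection *)

Lemma nth_weight_seq y k n (h u : nat -> nat) i :
  nth 0%R (weight_seq y k n h u) i =
  if i <= k then (n%:Z - (h i)%:Z)%R
  else if i < k.+1 + y.-1 then Posz (u (i - k)) else 0%R.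
Proof.
rewrite /weight_seq nth_cat size_map size_iota ltnS.
case: ifP => leik; first by rewrite (nth_map 0) ?size_iota // nth_iota.
case: ifP => ltN; last by rewrite nth_default // size_map size_iota; lia.
by rewrite (nth_map 0) ?size_iota ?nth_iota; try lia; congr (Posz (u _)); lia.
Qed.

(* With weights x - h_i the bijection exists for every B; the formula with
   lambda_1 - h_i agrees with it exactly when lambda_1 = x, and is false for
   every B with lambda_1 < x, because the x - lambda_1 last columns contribute
   to every h_i. *)
Theorem theorem7p1 (x y k : nat) (B : seq step) :
  1 <= k -> is_lpath x y B ->
  let T := nseq y North ++ nseq x East in
  let lam := shape_between x y T B in
  let lam1 := nth 0 lam 0 in
  exists Psi : k.-tuple (seq step) -> filling lam,
    forall h u : nat -> nat,
      set_bij (tuples_with x y k T B h u)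
              (flagged_tableaux k lam (weight_seq y k x h u)) Psi
      /\ (lam1 = x ->
          set_bij (tuples_with x y k T B h u)
                  (flagged_tableaux k lam (weight_seq y k lam1 h u)) Psi).
Proof.
move=> _ lB T ls lam1; pose lam := path_shape x y B.
have size_ls : size ls = y by rewrite size_map size_iota.
have nth_ls r : nth 0 ls r = rowlen lam r.
  have [ltr|lery] := ltnP r y; last first.
    by rewrite rowlen_default // nth_default ?size_ls.
  rewrite (nth_map 0) ?size_iota // nth_iota // rowlen_mkshape //; last first.
    by move=> j _; rewrite -[leqRHS]card_ord max_card.
  by apply: eq_card => a; rewrite !inE ht_top //; lia.
have part_lam : partb lam by apply: partb_path_shape.
have [phi [phiP phi_inj phi_surj]] := chain_bijection k lam.
pose Psi (P : k.-tuple _) := tableau_of ls (phi (fan_of x y B P)).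
(* [Psi] is fixed before [h] and [u] are chosen; the clause for [lam1 = x] then follows by
   rewriting. *)
suff bij h u : set_bij (tuples_with x y k T B h u)
    (flagged_tableaux k ls (weight_seq y k x h u)) Psi.
  by exists Psi => h u; split=> // ->.
have fan_ok (P : k.-tuple _) : path_tuples x y T B P -> fan_chain lam (fan_of x y B P).
  by move=> Pok; rewrite fan_chain_fan_of // (path_tuples_is_lpath lB).
have PsiP (P : k.-tuple _) : path_tuples x y T B P ->
  [/\ is_ssyt (Psi P), is_flagged k (Psi P) &
    has_weight (Psi P) (weight_seq y k x h u) <->
    (forall i, i <= k -> h_stat x T B P i = h i) /\
    (forall s, 1 <= s < y -> u_stat x y T B P s = u s)].
  move=> Pok; have [tok tw] := phiP _ (fan_ok P Pok).
  split; [exact: tableau_of_ssyt tok|exact: tableau_of_flagged tok|].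
  have cardE i : #|[pred c | Psi P c == i.+1]| =
      if i <= k then x - h_stat x T B P i
      else if i < k.+1 + y.-1 then u_stat x y T B P (i - k) else 0.
    rewrite (tableau_of_weight size_ls nth_ls tok); case: ifP => ltN; last first.
      by rewrite ifF //; lia.
    rewrite tw //; case: ifP => leik; first exact: fan_weight_h_stat.
    by rewrite -fan_weight_u_stat //; [congr fan_weight|]; lia.
  (* This bound makes the truncated subtraction from [x] in [nat] agree with the one in the
     integers. *)
  have h_le i : h_stat x T B P i <= x by rewrite -[leqRHS]card_ord max_card.
  split=> [wt|[eqh equ] i]; last first.
    rewrite cardE nth_weight_seq; case: ifP => leik.
      by rewrite -eqh //; have := h_le i; lia.
    by case: ifP => // ltN; rewrite equ //; lia.
  split=> [i leik|s lts].
    have := wt i; rewrite cardE nth_weight_seq leik; have := h_le i; lia.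
  have := wt (k + s); rewrite cardE nth_weight_seq ifF; last by lia.
  rewrite ifT; last by lia.
  by rewrite ifF ?ifT ?addKn; [case|lia|lia].
split=> [P [Pok eqh equ]|P Q|t [t_ssyt t_flag t_wt]].
- by have [ssyt flag wt] := PsiP P Pok; split=> //; apply/wt.
- rewrite !inE => -[Pok _ _] [Qok _ _] eqPQ; apply: (fan_of_inj lB Pok Qok).
  apply: phi_inj; rewrite ?fan_ok //.
  apply: (tableau_of_inj size_ls nth_ls) eqPQ.
    by have [] := phiP _ (fan_ok P Pok).
  by have [] := phiP _ (fan_ok Q Qok).
have [c c_ok eqt] := tableau_of_surj size_ls nth_ls part_lam t_ssyt t_flag.
have [d /(fan_of_surj lB)[P Pok fanP] eqc] := phi_surj c c_ok.
have PsiPt : Psi P = t by rewrite /Psi fanP eqc.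
exists P => //; have [_ _ [wt _]] := PsiP P Pok.
by have [] := wt; rewrite ?PsiPt.
Qed.
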